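(* For all integers $n \geq 0$ we have \[ |A_{2n + 1}(2143)| = \frac{2\, (3n + 3)!}{n!\,(n + 1)!\,(n + 2)!\, (2n + 1)(2n + 2)(2n + 3)}. \]
   Context: A permutation $w = w_1w_2\cdots w_m$ of length $m$ is a word containing each element of $[m]=\{1,\dots,m\}$ exactly once. It is alternating if $w_1 < w_2 > w_3 < w_4 > \cdots$ (up-down convention); $A_m$ is the set of alternating permutations of length $m$. A permutation $w$ contains the pattern $p = p_1 \cdots p_k \in S_k$ if there are indices $i_1 < \cdots < i_k$ such that $w_{i_\ell} < w_{i_r}$ if and only if $p_\ell < p_r$; otherwise $w$ avoids $p$. $A_m(p)$ is the set of elements of $A_m$ that avoid $p$, and $|S|$ denotes the size of the set $S$. *)

(* Defs.v *)
From HB Require Import structures.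
From mathcomp Require Import all_boot all_order all_algebra all_fingroup.

Set Implicit Arguments.
Unset Strict Implicit.
Unset Printing Implicit Defensive.

(* A permutation of [m] is w : 'S_m, with positions and values both shifted
   from {1, .., m} to {0, .., m-1}; its word is w 0, w 1, .., w (m-1). *)

(* Up-down convention w_1 < w_2 > w_3 < ...: because of the shift, an ascent
   starts at each even index and a descent at each odd one. *)
Definition alternating (m : nat) (w : 'S_m) : bool :=
  [forall i : 'I_m, forall j : 'I_m,
     (j == i.+1 :> nat) ==> (if odd i then w j < w i else w i < w j)].

Definition contains (m k : nat) (w : 'S_m) (p : 'S_k) : bool :=
  [exists f : {ffun 'I_k -> 'I_m},
     [forall l : 'I_k, forall r : 'I_k, (l < r) ==> (f l < f r)] &&
     [forall l : 'I_k, forall r : 'I_k, (w (f l) < w (f r)) == (p l < p r)]].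

Definition avoids (m k : nat) (w : 'S_m) (p : 'S_k) : bool :=
  ~~ contains w p.

Definition A_avoiding (m k : nat) (p : 'S_k) : {set 'S_m} :=
  [set w : 'S_m | alternating w & avoids w p].

Definition p2143 : 'S_4 :=
  (tperm (inord 0) (inord 1) * tperm (inord 2) (inord 3))%g.

Lemma p2143_word :
  [seq (p2143 i).+1 | i <- enum 'I_4] = [:: 2; 1; 4; 3].
Proof.
have E (a b : nat) : a < 4 -> b < 4 -> (inord a == inord b :> 'I_4) = (a == b).
  by move=> ha hb; rewrite -val_eqE /= !inordK.
have -> : enum 'I_4 = [seq inord i | i <- iota 0 4].
  apply: (inj_map val_inj); rewrite val_enum_ord -map_comp.
  by rewrite /= !inordK.
rewrite /= /p2143 !permM tpermL tpermR.
rewrite ![tperm (inord 0) _ _]tpermD ?E // tpermL tpermR.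
by rewrite !tpermD ?E // !inordK.
Qed.

(* Main.v *)
Require Import Defs.
From mathcomp Require Import all_boot all_order all_algebra all_fingroup.
From mathcomp Require Import zify ring lra.

(* Build a permutation of A_{2i+3}(2143) from one of A_{2i+1}(2143) by appending
   a peak c and a valley d. If x is the last entry and y the number of values
   c > x whose insertion creates no 2143, then d ranges over 0, .., x+1
   independently of c, and the label (x, y) of the child is (d, x + 2 - d + j),
   where j = 1, .., y is the rank from above of c among its possible values.
   Hence the labels alone determine the number of descendants. The same
   recursion is satisfied by the number of ways to complete a partly known word
   in three letters whose prefixes have contents a >= j >= k, and therefore
   |A_{2n+1}(2143)| is the sum over k <= n of the number of standard Young
   tableaux of shape (n, n, k). By the hook length formula the terms of this sum
   are hypergeometric in k, and the sum telescopes. *)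

Set Implicit Arguments.
Unset Strict Implicit.
Unset Printing Implicit Defensive.

(** * Permutations built by appending a last entry *)

(* Appends the entry [e]; the entries of [s] that are at least [e] move up by one. *)
Definition rcons_perm (m : nat) (s : 'S_m) (e : 'I_m.+1) : 'S_m.+1 :=
  lift_perm ord_max e s.

Lemma rcons_perm_max (m : nat) (s : 'S_m) (e : 'I_m.+1) :
  rcons_perm s e ord_max = e.
Proof. exact: lift_perm_id. Qed.

Lemma rcons_perm_lift (m : nat) (s : 'S_m) (e : 'I_m.+1) (i : 'I_m) :
  rcons_perm s e (lift ord_max i) = bump e (s i) :> nat.
Proof. by rewrite /rcons_perm lift_perm_lift. Qed.

Lemma lift_ord_max (m : nat) (i : 'I_m) :
  lift (ord_max : 'I_m.+1) i = i :> nat.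
Proof. exact: lift_max. Qed.

Lemma unlift_ord_max (m : nat) (i : 'I_m.+1) :
  (exists i' : 'I_m, i = lift ord_max i') \/ i = ord_max.
Proof. by case: (unliftP ord_max i) => [i'|] ->; [left; exists i' | right]. Qed.

Lemma ltn_bump (e a b : nat) : (bump e a < bump e b) = (a < b).
Proof. by rewrite /bump; lia. Qed.

Lemma sum_rcons_perm (m : nat) (F : 'S_m.+1 -> nat) :
  \sum_(w : 'S_m.+1) F w =
  \sum_(s : 'S_m) \sum_(e : 'I_m.+1) F (rcons_perm s e).
Proof.
pose h (p : 'S_m * 'I_m.+1) := rcons_perm p.1 p.2.
have inj_h : injective h.
  move=> [s e] [s' e'] /permP E; have:= E ord_max.
  rewrite /h /= !rcons_perm_max => Ee; subst e'; congr (_, _).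
  apply/permP=> i; have:= E (lift ord_max i).
  by rewrite /h /rcons_perm /= !lift_perm_lift => /lift_inj.
have bij_h : bijective h.
  apply: inj_card_bij => //.
  by rewrite card_prod card_ord !card_Sn factS mulnC.
rewrite pair_big (reindex h) //=; exact: onW_bij.
Qed.

(** * Occurrences of 2143 and of its initial parts *)

Definition has_inv_below (m : nat) (s : 'S_m) (v : nat) : bool :=
  [exists i : 'I_m, exists j : 'I_m, [&& i < j, s j < s i & s i < v]].

(** Here [c] is the value of an entry still to be appended in the role of the 3; old entries at
    least [c] will move above it, hence the weak inequality for the 4. *)
Definition completes_2143 (m : nat) (s : 'S_m) (c : nat) : bool :=
  [exists i : 'I_m, exists j : 'I_m, exists k : 'I_m,
     [&& i < j, j < k, s j < s i, s i < c & c <= s k]].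

Definition has_2143 (m : nat) (s : 'S_m) : bool :=
  [exists i : 'I_m, exists j : 'I_m, exists k : 'I_m, exists l : 'I_m,
     [&& i < j, j < k, k < l, s j < s i, s i < s l & s l < s k]].

Lemma p2143E (i : 'I_4) : p2143 i = nth 0 [:: 1; 0; 3; 2] i :> nat.
Proof.
have := congr1 (fun t => nth 0 t i) p2143_word.
rewrite (nth_map i) ?size_enum_ord // nth_ord_enum.
by case: i => [[|[|[|[|//]]]] Hi] /= [].
Qed.

Lemma containsE (m : nat) (s : 'S_m) : contains s p2143 = has_2143 s.
Proof.
apply/existsP/idP=> [[f /andP[/forallP mono /forallP pat]]|].
  pose o a := f (inord a : 'I_4).
  have lt a b : a < b < 4 -> o a < o b.
    move=> ab; move/forallP/(_ (inord b))/implyP: (mono (inord a)).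
    by apply; rewrite !inordK //; lia.
  have pt a b : a < 4 -> b < 4 ->
      (s (o a) < s (o b)) = (nth 0 [:: 1; 0; 3; 2] a < nth 0 [:: 1; 0; 3; 2] b).
    move=> a4 b4; move/forallP/(_ (inord b))/eqP: (pat (inord a)).
    by rewrite !p2143E !inordK.
  apply/existsP; exists (o 0); apply/existsP; exists (o 1).
  apply/existsP; exists (o 2); apply/existsP; exists (o 3).
  by rewrite !lt // !pt.
case/existsP=> i /existsP[j /existsP[k /existsP[l]]] H.
exists [ffun a : 'I_4 => nth i [:: i; j; k; l] a].
apply/andP; split; apply/forallP=> -[a Ha]; apply/forallP=> -[b Hb].
  by rewrite !ffunE /=; move: a b Ha Hb => [|[|[|[|//]]]] [|[|[|[|//]]]] _ _ //=;
     lia.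
rewrite !ffunE !p2143E /=.
by move: a b Ha Hb => [|[|[|[|//]]]] [|[|[|[|//]]]] _ _ /=; apply/eqP; lia.
Qed.


Lemma has_inv_belowP (m : nat) (s : 'S_m) (v : nat) :
  reflect (exists i j : 'I_m, [&& i < j, s j < s i & s i < v])
          (has_inv_below s v).
Proof.
apply: (iffP existsP) => [[i /existsP[j H]]|[i [j H]]]; first by exists i, j.
by exists i; apply/existsP; exists j.
Qed.

Lemma completes_2143P (m : nat) (s : 'S_m) (c : nat) :
  reflect (exists i j k : 'I_m,
             [&& i < j, j < k, s j < s i, s i < c & c <= s k])
          (completes_2143 s c).
Proof.
apply: (iffP existsP) => [[i /existsP[j /existsP[k H]]]|[i [j [k H]]]].
  by exists i, j, k.
by exists i; apply/existsP; exists j; apply/existsP; exists k.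
Qed.

Lemma has_2143P (m : nat) (s : 'S_m) :
  reflect (exists i j k l : 'I_m,
             [&& i < j, j < k, k < l, s j < s i, s i < s l & s l < s k])
          (has_2143 s).
Proof.
apply: (iffP existsP) => [[i /existsP[j /existsP[k /existsP[l H]]]]|].
  by exists i, j, k, l.
move=> [i [j [k [l H]]]].
exists i; apply/existsP; exists j; apply/existsP; exists k.
by apply/existsP; exists l.
Qed.

(** * Effect of an appended entry on patterns and alternation *)

Section Rcons.
Variables (m : nat) (s : 'S_m) (e : 'I_m.+1).

Lemma unlift_lt (i j : 'I_m.+1) :
  i < j -> exists2 i' : 'I_m, i = lift ord_max i' & i = i' :> nat.
Proof.
case: (unlift_ord_max i) => [[i' ->]|->] lt_ij.
  by exists i'; rewrite ?lift_ord_max.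
by have:= ltn_ord j; move: lt_ij => /=; lia.
Qed.

Lemma has_2143_rcons :
  has_2143 (rcons_perm s e) = has_2143 s || completes_2143 s e.
Proof.
apply/has_2143P/orP.
  move=> [i [j [k [l /and5P[ij jk kl]]]]].
  have [i' Ei' Ei] := unlift_lt ij; subst i; have [j' Ej' Ej] := unlift_lt jk; subst j.
  have [k' Ek' Ek] := unlift_lt kl; subst k.
  have [[l' El]|El] := unlift_ord_max l; subst l.
    rewrite !rcons_perm_lift !ltn_bump => H1 H2; left; apply/has_2143P.
    by exists i', j', k', l'; move: kl; rewrite !lift_ord_max; lia.
  rewrite !rcons_perm_lift rcons_perm_max ltn_bump => H1 H2; right.
  by apply/completes_2143P; exists i', j', k'; rewrite /bump in H2; lia.
case=> [/has_2143P[i [j [k [l H]]]]|/completes_2143P[i [j [k H]]]].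
  exists (lift ord_max i), (lift ord_max j), (lift ord_max k), (lift ord_max l).
  by rewrite !rcons_perm_lift !lift_ord_max !ltn_bump.
exists (lift ord_max i), (lift ord_max j), (lift ord_max k), ord_max.
rewrite !rcons_perm_lift rcons_perm_max !lift_ord_max !ltn_bump /= ltn_ord.
by rewrite /bump; lia.
Qed.

(** The appended entry stands after every inversion and is high enough to be the 4. *)
Lemma completes_2143_rcons_le (c : nat) : c <= e ->
  completes_2143 (rcons_perm s e) c = has_inv_below s c.
Proof.
move=> le_ce; apply/completes_2143P/has_inv_belowP.
  move=> [i [j [k /and5P[ij jk]]]].
  have [i' Ei' Ei] := unlift_lt ij; subst i; have [j' Ej' Ej] := unlift_lt jk; subst j.
  rewrite !rcons_perm_lift !ltn_bump => H1 H2 _.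
  by exists i', j'; rewrite /bump in H2; lia.
move=> [i [j H]]; exists (lift ord_max i), (lift ord_max j), ord_max.
rewrite !rcons_perm_lift rcons_perm_max !lift_ord_max !ltn_bump /= ltn_ord.
by rewrite /bump; lia.
Qed.

(** The appended entry is too low to be the 4 and, being last, cannot be the 2 or the 1. *)
Lemma completes_2143_rcons_gt (c : nat) : e <= c ->
  completes_2143 (rcons_perm s e) c.+1 = completes_2143 s c.
Proof.
move=> le_ec; apply/completes_2143P/completes_2143P.
  move=> [i [j [k /and5P[ij jk]]]].
  have [i' Ei' Ei] := unlift_lt ij; subst i; have [j' Ej' Ej] := unlift_lt jk; subst j.
  have [[k' Ek]|Ek] := unlift_ord_max k; subst k; last first.
    by rewrite rcons_perm_max; lia.
  rewrite !rcons_perm_lift !ltn_bump => H1 H2 H3.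
  by exists i', j', k'; move: jk H2 H3; rewrite !lift_ord_max /bump; lia.
move=> [i [j [k H]]]; exists (lift ord_max i), (lift ord_max j), (lift ord_max k).
by rewrite !rcons_perm_lift !lift_ord_max !ltn_bump /bump; lia.
Qed.
End Rcons.

Lemma alternating_rcons (m : nat) (s : 'S_m.+1) (e : 'I_m.+2) :
  alternating (rcons_perm s e) =
  alternating s && (if odd m then e <= s ord_max else s ord_max < e).
Proof.
have bumpe v : (bump e v < e) = (v < e) by rewrite /bump; lia.
have ebump v : (e < bump e v) = (e <= v) by rewrite /bump; lia.
apply/'forall_forallP/andP=> [H|[/'forall_forallP H Hm] i j].
  split.
    apply/'forall_forallP=> i j; apply/implyP=> ij.
    have /implyP := H (lift ord_max i) (lift ord_max j).
    by rewrite !rcons_perm_lift !lift_ord_max !ltn_bump => /(_ ij).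
  have /implyP := H (lift ord_max ord_max) ord_max.
  by rewrite rcons_perm_lift rcons_perm_max lift_ord_max bumpe ebump /= eqxx => /(_ isT).
apply/implyP=> /eqP ij; have lt_ij : i < j by rewrite ij.
have [i' Ei' Ei] := unlift_lt lt_ij; subst i.
have [[j' Ej]|Ej] := unlift_ord_max j; subst j.
  rewrite !rcons_perm_lift !ltn_bump lift_ord_max.
  by move: (H i' j') ij => /implyP H' ij; apply/H'/eqP; rewrite !lift_ord_max in ij.
have Em : i' = ord_max by apply: val_inj; move: ij; rewrite lift_ord_max /= => -[].
by rewrite Em rcons_perm_lift rcons_perm_max lift_ord_max bumpe ebump.
Qed.

(** * Generating tree: appending a peak and a valley *)

Definition alt_avoiding (m : nat) (s : 'S_m) : bool :=
  alternating s && ~~ has_2143 s.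

(* An inversion whose larger entry is below the last entry of [s] would form a
   2143 pattern with the last two entries, a peak followed by a valley. *)
Lemma has_inv_belowE (m : nat) (s : 'S_m.+1) (v : nat) :
  ~~ odd m -> alt_avoiding s -> v <= m.+1 ->
  has_inv_below s v = ((s ord_max).+1 < v).
Proof.
move=> ev_m /andP[/'forall_forallP alt_s av_s] le_vm.
apply/has_inv_belowP/idP=> [[i [j /and3P[ij sij sv]]]|lt_xv].
  apply: leq_trans sv; rewrite ltnS ltnNge; apply/negP=> le_ix.
  case: m => [|m] in s ev_m alt_s av_s le_vm i j ij sij le_ix *.
    by rewrite (ord1 i) (ord1 j) in ij.
  have lt_m : m < m.+2 by [].
  pose p := Ordinal lt_m.
  have sp : s ord_max < s p.
    have /implyP /(_ (eqxx _)) := alt_s p ord_max.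
    by move: ev_m; rewrite /= => /negbNE ->.
  have lt_ix : s i < s ord_max.
    rewrite ltn_neqAle le_ix andbT; apply/negP=> /eqP /val_inj /perm_inj Ei.
    by move: ij (ltn_ord j); rewrite Ei /=; lia.
  have j_p : j != p by apply/eqP=> Ej; subst j; lia.
  have j_max : j != ord_max by apply/eqP=> Ej; subst j; lia.
  case/negP: av_s; apply/has_2143P; exists i, j, p, ord_max.
  move: j_p j_max; rewrite -!val_eqE /= ij sij sp lt_ix /=.
  by have := ltn_ord j; lia.
have lt_x : (s ord_max).+1 < m.+1 by lia.
(* With x the last entry, the value x + 1 stands before it and forms an inversion with it. *)
pose i := (s^-1)%g (Ordinal lt_x); exists i, ord_max.
have Ei : s i = (s ord_max).+1 :> nat by rewrite permKV.
rewrite Ei ltnSn lt_xv !andbT ltn_neqAle leq_ord andbT.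
apply/eqP=> Em; have Ei' : i = ord_max by apply: val_inj.
by rewrite Ei' in Ei; lia.
Qed.

(** The peak [c] can be the 4 for the valley [d], so [d] is allowed iff no inversion lies below it,
    that is, iff d <= x + 1. As x < c, the descent d <= c is then automatic. *)
Lemma alt_avoiding_rcons2 (m : nat) (s : 'S_m.+1) (c : 'I_m.+2) (d : 'I_m.+3) :
  ~~ odd m ->
  alt_avoiding (rcons_perm (rcons_perm s c) d) =
  alt_avoiding s &&
    [&& s ord_max < c, ~~ completes_2143 s c & d <= (s ord_max).+1].
Proof.
move=> ev_m; have [av_s|nav_s] := boolP (alt_avoiding s); last first.
  apply: contraNF nav_s; rewrite /alt_avoiding !alternating_rcons !has_2143_rcons.
  by rewrite !negb_or => /andP[/andP[/andP[-> _] _] /andP[/andP[-> _] _]].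
move: (av_s) => /andP[alt_s av_s']; rewrite /alt_avoiding !alternating_rcons.
rewrite !has_2143_rcons !negb_or alt_s av_s' rcons_perm_max /= ev_m (negPf ev_m).
have [lt_xc /=|] := ltnP (s ord_max) c; last by [].
have [le_dc|lt_cd] /= := leqP d c; last by rewrite andbC; lia.
rewrite completes_2143_rcons_le // has_inv_belowE // -?leqNgt //.
by have := ltn_ord c; lia.
Qed.

(** * Labels of the generating tree *)

Definition num_active (m : nat) (s : 'S_m.+1) : nat :=
  \sum_(0 <= c < m.+2) ((s ord_max < c) && ~~ completes_2143 s c).

Lemma sum_interval (a b N : nat) : b <= N ->
  \sum_(0 <= i < N) (a <= i < b) = b - a.
Proof.
move=> le_bN; suff -> : \sum_(0 <= i < N) (a <= i < b) = minn b N - a by lia.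
elim: N {le_bN} => [|N IH]; first by rewrite big_nil; lia.
by rewrite big_nat_recr //= IH; case: (leqP a N); case: (ltnP N b) => /=; lia.
Qed.

(** The peak ends up with value c + 1. A new value v <= c + 1 can use it as the 4, so v is active
    iff d < v <= x + 2. For v >= c + 2 neither new entry can be the 4, and v is active iff v - 2
    was. *)
Lemma num_active_rcons2 (m : nat) (s : 'S_m.+1) (c : 'I_m.+2) (d : 'I_m.+3) :
  ~~ odd m -> alt_avoiding s -> s ord_max < c -> d <= (s ord_max).+1 ->
  num_active (rcons_perm (rcons_perm s c) d) =
  ((s ord_max).+2 - d) +
  \sum_(c <= c' < m.+2) ((s ord_max < c') && ~~ completes_2143 s c').
Proof.
move=> ev_m av_s lt_xc le_dx; rewrite /num_active rcons_perm_max.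
rewrite big_nat_recl // ltn0 add0n.
have lt_cm := ltn_ord c.
rewrite (@big_cat_nat _ _ _ c.+1) //=; last by lia.
congr (_ + _).
  rewrite -[RHS](@sum_interval d (s ord_max).+2 c.+1); last by lia.
  apply: eq_big_nat => i /andP[_ lt_ic]; rewrite ltnS; congr nat_of_bool.
  have [le_di|//] := leqP d i.
  rewrite completes_2143_rcons_gt // completes_2143_rcons_le //.
  by rewrite has_inv_belowE //; lia.
rewrite big_add1 /=; apply: eq_big_nat => i /andP[le_ci lt_im].
rewrite !completes_2143_rcons_gt //; last by lia.
by congr nat_of_bool; lia.
Qed.

(** As [c] descends through [P], its rank from above takes the values 1, 2, and so on; the induction
    lowers [a] from [N]. *)
Lemma sum_rank (P : pred nat) (G : nat -> nat) (a N : nat) :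
  \sum_(a <= c < N | P c) G (\sum_(c <= c' < N) P c') =
  \sum_(1 <= j < (\sum_(a <= c < N) P c).+1) G j.
Proof.
have [le_aN|lt_Na] := leqP a N; last by rewrite !big_geq //; lia.
rewrite -(subKn le_aN); move: (leq_subr a N); move: (N - a) => k.
elim: k => [|k IH] le_kN; first by rewrite subn0 !big_geq.
have lt_N : N - k.+1 < N by lia.
have E : (N - k.+1).+1 = N - k by lia.
rewrite big_ltn_cond // E IH; last by lia.
have -> : \sum_(N - k.+1 <= c < N) P c =
    P (N - k.+1) + \sum_(N - k <= c < N) P c by rewrite big_ltn // E.
case Pa: (P (N - k.+1)); last by rewrite add0n.
by rewrite add1n [RHS]big_nat_recr //= addnC.
Qed.

Fixpoint descendants (n x y : nat) : nat :=
  if n is n'.+1 then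
    \sum_(0 <= d < x.+2) \sum_(1 <= j < y.+1) descendants n' d (x.+2 - d + j)
  else 1.

Lemma sum_children (m : nat) (F : nat -> nat -> nat) : ~~ odd m ->
  \sum_(w : 'S_m.+3 | alt_avoiding w) F (w ord_max) (num_active w) =
  \sum_(s : 'S_m.+1 | alt_avoiding s)
    \sum_(0 <= d < (s ord_max).+2) \sum_(1 <= j < (num_active s).+1)
      F d ((s ord_max).+2 - d + j).
Proof.
move=> ev_m; rewrite big_mkcond sum_rcons_perm sum_rcons_perm [RHS]big_mkcond.
apply: eq_bigr => s _; have [av_s|nav_s] := boolP (alt_avoiding s); last first.
  apply: big1 => c _; apply: big1 => d _.
  by rewrite alt_avoiding_rcons2 // (negPf nav_s).
set x := nat_of_ord (s ord_max).
pose P c := (x < c) && ~~ completes_2143 s c.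
transitivity (\sum_(c < m.+2 | P c) \sum_(0 <= d < x.+2)
    F d (x.+2 - d + \sum_(c <= c' < m.+2) P c')).
  rewrite [RHS]big_mkcond; apply: eq_bigr => c _.
  transitivity (\sum_(d < m.+3) if P c && (d < x.+2) then
      F d (x.+2 - d + \sum_(c <= c' < m.+2) P c') else 0).
    apply: eq_bigr => d _; rewrite alt_avoiding_rcons2 // av_s /= andbA.
    case: ifP => // /andP[/andP[lt_xc _] le_dx].
    by rewrite rcons_perm_max num_active_rcons2.
  case: (boolP (P c)) => [/andP[lt_xc _]|_]; last by rewrite big1.
  rewrite -big_mkcond /= big_mkord.
  rewrite (big_ord_widen m.+3
    (fun d => F d (x.+2 - d + \sum_(c <= c' < m.+2) P c'))) //.
  by have := ltn_ord c; lia.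
rewrite exchange_big /= ; apply: eq_bigr => d _.
rewrite -[RHS](sum_rank P (fun j => F d (x.+2 - d + j)) 0 m.+2).
by rewrite big_mkord.
Qed.

(** Trading a generation of permutations for one of labels keeps n + k fixed. It ends at the
    permutation of length 1, with label (0, 1); k = 0 gives the plain count. *)
Lemma sum_descendants (n k : nat) :
  \sum_(w : 'S_n.*2.+1 | alt_avoiding w)
    descendants k (w ord_max) (num_active w) = descendants (n + k) 0 1.
Proof.
elim: n k => [|n IH] k; last first.
  by rewrite sum_children ?odd_double // addSnnS -IH.
rewrite (bigD1 1%g) /=; last first.
  apply/andP; split.
    by apply/'forall_forallP=> i j; rewrite (ord1 i) (ord1 j).
  by apply/has_2143P=> -[i [j [a [b H]]]]; move: H; rewrite (ord1 i) (ord1 j).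
rewrite big1 ?addn0 => [|w /andP[_ /eqP []]]; last first.
  by apply/permP=> i; rewrite !ord1.
rewrite /num_active big_nat_recl // big_nat1 perm1 /=.
suff -> : completes_2143 (1%g : 'S_1) 1 = false by [].
by apply/completes_2143P=> -[i [j [a H]]]; move: H; rewrite (ord1 i) (ord1 j).
Qed.

Lemma card_A_avoiding (n : nat) :
  #|A_avoiding n.*2.+1 p2143| = descendants n 0 1.
Proof.
rewrite -[n in RHS]addn0 -sum_descendants sum1_card.
by apply: eq_card => w; rewrite !inE /avoids containsE.
Qed.

(** * Lattice paths through three-row partitions and the hook length formula *)

Definition partition3 (a j k : nat) : bool := (j <= a) && (k <= j).

(** From the origin these are the standard Young tableaux of shape (a', j', k'). Only the points
    reached by a step are tested for being partitions. *)
Fixpoint paths (N a j k a' j' k' : nat) : nat :=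
  if N is N'.+1 then
    partition3 a.+1 j k * paths N' a.+1 j k a' j' k' +
    partition3 a j.+1 k * paths N' a j.+1 k a' j' k' +
    partition3 a j k.+1 * paths N' a j k.+1 a' j' k'
  else [&& a == a', j == j' & k == k'].

(** Splitting off the last step instead of the first allows induction on the final shape. *)
Lemma paths_last (N a j k a' j' k' : nat) :
  paths N.+1 a j k a' j' k' =
  partition3 a' j' k' *
    ((if a' is a1.+1 then paths N a j k a1 j' k' else 0) +
     (if j' is j1.+1 then paths N a j k a' j1 k' else 0) +
     (if k' is k1.+1 then paths N a j k a' j' k1 else 0)).
Proof.
elim: N a j k => [|N IH] a j k.
  have E x y z : partition3 x y z * [&& x == a', y == j' & z == k'] =
      partition3 a' j' k' * [&& x == a', y == j' & z == k'].
    by case: and3P => [[/eqP -> /eqP -> /eqP ->]|]; rewrite ?muln0.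
  rewrite [LHS]/= !E -!mulnDr; congr (_ * (_ + _ + _)).
  - by case: a' {E}.
  - by case: j' {E} => //; rewrite andbF.
  - by case: k' {E} => //; rewrite !andbF.
rewrite [LHS]/= -!/(paths N.+1 _ _ _ _ _ _) !IH.
by case: a' j' k' {IH} => [|a'] [|j'] [|k'] /=; ring.
Qed.

Lemma paths_gt (N a j k a' j' k' : nat) : a' < a -> paths N a j k a' j' k' = 0.
Proof.
elim: N a j k => [|N IH] a j k lt_a /=; first by case: eqP => //; lia.
by rewrite !IH //; lia.
Qed.

(** Induction by removing the last box from row 1, 2 or 3 ([p1], [p2], [p3]). The row differences
    [s] and [r] avoid subtraction, and the factors s, r, k in [H1], [H2], [H3] vanish exactly when
    the row has no removable box. *)
Lemma paths_hook_length (N k r s : nat) : N = 3 * k + 2 * r + s ->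
  paths N 0 0 0 (k + r + s) (k + r) k *
    ((k + r + s).+2`! * (k + r).+1`! * k`!) =
  N`! * (s.+1 * (r + s).+2 * r.+1).
Proof.
elim: N k r s => [|N IH] k r s EN.
  by have [-> -> ->] : [/\ k = 0, r = 0 & s = 0] by split; lia.
rewrite paths_last.
have -> : partition3 (k + r + s) (k + r) k by rewrite /partition3; lia.
rewrite mul1n; set p1 := (if k + r + s is _.+1 then _ else 0).
set p2 := (if k + r is _.+1 then _ else 0).
set p3 := (if k is _.+1 then _ else 0).
set D := _.+2`! * _ * _.
have inv0 M a j k' : ~~ partition3 a j k' -> 0 < a + j + k' ->
    paths M 0 0 0 a j k' = 0.
  case: M => [|M] nv n0; last by rewrite paths_last (negPf nv).
  by case: a j k' n0 {nv} => [|?] [|?] [|?].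
have H1 : p1 * D = N`! * ((k + r + s).+2 * (s * (r + s).+1 * r.+1)).
  rewrite /p1 /D; case: s EN {p1 p2 p3 D} => [|s] EN.
    rewrite addn0 mul0n !(mul0n, muln0).
    by case E: (k + r) => [|t] //; rewrite inv0 // /partition3; lia.
  rewrite addnS factS.
  have := IH k r s; rewrite addnS => IH'.
  transitivity ((k + r + s).+3 * (paths N 0 0 0 (k + r + s) (k + r) k *
    ((k + r + s).+2`! * (k + r).+1`! * k`!))); first by ring.
  by rewrite IH'; [ring | lia].
have H2 : p2 * D = N`! * ((k + r).+1 * (s.+2 * (r + s).+2 * r)).
  rewrite /p2 /D; case: r EN {H1 p1 p2 p3 D} => [|r] EN.
    rewrite addn0 !muln0; case: k EN => [|k] EN //; rewrite inv0 //.
    by rewrite /partition3; lia.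
  rewrite addnS [(k + r).+2`!]factS.
  have -> : (k + r).+1 + s = k + r + s.+1 by lia.
  transitivity ((k + r).+2 * (paths N 0 0 0 (k + r + s.+1) (k + r) k *
    ((k + r + s.+1).+2`! * (k + r).+1`! * k`!))); first by ring.
  by rewrite IH; [rewrite !addnS !addSn; ring | lia].
have H3 : p3 * D = N`! * (k * (s.+1 * (r + s).+3 * r.+2)).
  rewrite /p3 /D; case: k EN {H1 H2 p1 p2 p3 D} => [|k] EN.
    by rewrite !(mul0n, muln0).
  rewrite [k.+1`!]factS.
  have -> : k.+1 + r = k + r.+1 by lia.
  transitivity (k.+1 * (paths N 0 0 0 (k + r.+1 + s) (k + r.+1) k *
    ((k + r.+1 + s).+2`! * (k + r.+1).+1`! * k`!))); first by ring.
  by rewrite IH; [rewrite !addSn; ring | lia].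
rewrite factS EN [LHS]mulnDl [X in X + _]mulnDl H1 H2 H3; ring.
Qed.

(** * Completions of partly known words *)

Section Completions.
Variable n : nat.

(** The coordinate sums force the length. If the subtraction truncates, the empty path misses the
    target and the count is 0. *)
Definition paths_to (a j k k' : nat) : nat :=
  paths (n + n + k' - (a + j + k)) a j k n n k'.

(* The number of lattice paths from [(a, j, k)] to the points [(n, n, _)]; each
   of them is continued by one step to the row [j = n.+1], where it stops. *)
Definition completions (a j k : nat) : nat :=
  if j == n.+1 then nat_of_bool ((a == n) && (k <= n))
  else partition3 a j k * \sum_(0 <= k' < n.+1) paths_to a j k k'.

Lemma paths_to_step (a j k k' : nat) :
  paths_to a j k k' =
  [&& a == n, j == n & k == k'] + (partition3 a.+1 j k * paths_to a.+1 j k k' +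
    partition3 a j.+1 k * paths_to a j.+1 k k' +
    partition3 a j k.+1 * paths_to a j k.+1 k').
Proof.
have [le_v|lt_u] := leqP (n + n + k') (a + j + k).
  have E a1 j1 k1 : n + n + k' <= a1 + j1 + k1 ->
      paths_to a1 j1 k1 k' = [&& a1 == n, j1 == n & k1 == k'].
    by rewrite /paths_to -subn_eq0 => /eqP ->.
  have F a1 j1 k1 : n + n + k' < a1 + j1 + k1 -> paths_to a1 j1 k1 k' = 0.
    move=> lt_v; rewrite E ?(ltnW lt_v) //.
    by case: and3P => // -[/eqP ? /eqP ? /eqP ?]; lia.
  by rewrite E // !F ?muln0 ?addn0 //; lia.
rewrite /paths_to.
have -> : n + n + k' - (a + j + k) = (n + n + k' - (a + j + k).+1).+1 by lia.
have -> : [&& a == n, j == n & k == k'] = false.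
  by apply/and3P=> -[/eqP ? /eqP ? /eqP ?]; lia.
by rewrite add0n !(addSn, addnS).
Qed.

Lemma completions_over (j k : nat) : j <= n -> completions n.+1 j k = 0.
Proof.
move=> le_jn; rewrite /completions ifN; last by lia.
by rewrite big1 ?muln0 // => k' _; apply: paths_gt.
Qed.

Lemma completions_not_partition (a j k : nat) :
  j <= n -> ~~ partition3 a j k -> completions a j k = 0.
Proof.
by move=> le_jn /negPf nv; rewrite /completions nv ifN //; lia.
Qed.

(** Sort by the first step. At a = j = n the empty path, counted once in the sum over k',
    corresponds to the final step into the row j = n + 1. *)
Lemma completions_step (a j k : nat) : k <= j -> j <= a -> a <= n ->
  completions a j k =
  completions a.+1 j k + completions a j.+1 k + completions a j k.+1.
Proof.
move=> le_kj le_ja le_an.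
have Nj : (j == n.+1) = false by lia.
have v : partition3 a j k by rewrite /partition3; lia.
rewrite {1 2 4}/completions Nj v mul1n.
rewrite (eq_big_nat _ _ (fun k' _ => paths_to_step a j k k')) !big_split /=.
rewrite -!big_distrr /= {1}/completions.
have [Ejn|Njn] := eqVneq j n; last first.
  have -> : (j.+1 == n.+1) = false by lia.
  rewrite [X in X + _ = _]big1 ?add0n ?addnA // => k' _.
  by rewrite andbF.
rewrite {}Ejn in le_kj le_ja v *.
have {le_ja le_an} -> : a = n by lia.
have -> : partition3 n n.+1 k = false by rewrite /partition3; lia.
rewrite [X in X + _ = _](_ : _ = 1); first by rewrite !eqxx le_kj /=; lia.
rewrite -[RHS](subSnn k) -(sum_interval k (b := k.+1) (N := n.+1)) //.
by apply: eq_bigr => i _; rewrite eqxx /=; congr nat_of_bool; lia.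
Qed.

(** * Words with open gaps and comparison with the labels *)

Lemma sum_telescope (f g : nat -> nat) (a b : nat) : a <= b ->
  (forall i, a <= i < b -> f i = f i.+1 + g i) ->
  \sum_(a <= i < b) g i + f b = f a.
Proof.
elim: b => [|b IH] le_ab fg; first by rewrite big_geq //; congr f; lia.
have [Eab|lt_ab] := eqVneq a b.+1; first by rewrite -Eab big_geq.
rewrite big_nat_recr /=; last by lia.
rewrite -IH => [||i Hi]; [|lia|apply: fg; lia].
by rewrite (fg b); lia.
Qed.

(* [gap_completions t a j k] extends the count to states in which the letters of
   the second and third kind are already known for the next [t] places, while
   those of the first kind still have to be inserted among them. *)
Fixpoint gap_completions (t a j k : nat) : nat :=
  if t is t'.+1 then \sum_(a <= a' < n.+1) gap_completions t' a' j k
  else completions a j k.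

Lemma gap_completions_not_partition (t a j k : nat) :
  j <= n -> j < k -> gap_completions t a j k = 0.
Proof.
move=> le_jn lt_jk; elim: t a => [|t IH] a /=.
  by rewrite completions_not_partition // /partition3; lia.
by rewrite big1.
Qed.

(** Some letters of the first kind precede the next letter of another kind. Fixing the latter and
    postponing their number opens a new gap; for t = 0 this is [completions_step] telescoped over
    a. *)
Lemma gap_completions_step (t a j k : nat) : k <= j -> j <= a -> a <= n ->
  gap_completions t a j k =
  gap_completions t.+1 a j.+1 k + gap_completions t.+1 a j k.+1.
Proof.
move=> le_kj; elim: t a => [|t IH] a le_ja le_an.
  rewrite /= -big_split /=.
  rewrite -(sum_telescope (f := fun i => completions i j k)
    (g := fun i => completions i j.+1 k + completions i j k.+1)
    (a := a) (b := n.+1)).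
  - by rewrite completions_over ?addn0 //; lia.
  - by lia.
  - by move=> i Hi; rewrite completions_step ?addnA //; lia.
rewrite [LHS]/= (eq_big_nat _ _ (F2 := fun a' =>
  gap_completions t.+1 a' j.+1 k + gap_completions t.+1 a' j k.+1)).
  by rewrite big_split.
by move=> i Hi; apply: IH; lia.
Qed.

(** As j exceeds a, some gap must receive a letter of the first kind; [r] counts the gaps from the
    first such gap on. *)
Lemma gap_completions_above (t i k : nat) : i < n ->
  gap_completions t i i.+1 k =
  \sum_(1 <= r < t.+1) gap_completions r i.+1 i.+1 k.
Proof.
move=> lt_in; elim: t => [|t IH].
  rewrite big_geq //= completions_not_partition // /partition3; lia.
by rewrite big_nat_recr // -IH /= big_ltn //; lia.
Qed.

(** Sort by the number e - 1 - d of letters of the third kind before the next one of the second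
    kind. Each of these letters opens a gap, and k cannot exceed j = a. *)
Lemma gap_completions_diag (e r a : nat) : e <= a.+1 -> a <= n ->
  gap_completions r a a (a.+1 - e) =
  \sum_(0 <= d < e) gap_completions (r + e - d) a a.+1 (a - d).
Proof.
elim: e r => [|e IH] r le_ea le_an.
  by rewrite big_geq // gap_completions_not_partition //; lia.
rewrite gap_completions_step //; try by lia.
have -> : (a.+1 - e.+1).+1 = a.+1 - e by lia.
rewrite IH //; last by lia.
rewrite big_nat_recr // addnC; congr (_ + _).
  by apply: eq_big_nat => d Hd; congr gap_completions; lia.
by congr gap_completions; lia.
Qed.

(** Dictionary: x = i - k, [y] is the number of open gaps, and [m] letters of the first kind remain.
    The first gap used gives the rank of the peak, and the next letter of the second kind gives the
    valley [d], with e = x + 2. *)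
Lemma descendants_gap_completions (m i x y : nat) : m + i = n -> x <= i ->
  descendants m x y = gap_completions y i i.+1 (i - x).
Proof.
elim: m i x y => [|m IH] i x y Emi le_xi.
  have {Emi} -> : i = n by lia.
  elim: y => [|y IHy]; first by rewrite /= /completions !eqxx leq_subr.
  by rewrite /= big_nat1 -IHy.
rewrite gap_completions_above; last by lia.
rewrite /= exchange_big /=; apply: eq_big_nat => r Hr.
have -> : i - x = i.+2 - x.+2 by lia.
rewrite gap_completions_diag; try by lia.
apply: eq_big_nat => d Hd; rewrite (IH i.+1); try by lia.
by congr gap_completions; lia.
Qed.

Lemma descendants_root :
  descendants n 0 1 = \sum_(0 <= k < n.+1) paths (n + n + k) 0 0 0 n n k.
Proof.
rewrite (@descendants_gap_completions n 0) ?addn0 //.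
(* At the origin the next letter not of the first kind must be of the second, which yields the state
   of the root label (0, 1). *)
transitivity (completions 0 0 0).
  rewrite -[RHS]/(gap_completions 0 0 0 0) [RHS]gap_completions_step //.
  by rewrite [X in _ = _ + X]gap_completions_not_partition ?addn0.
rewrite /completions /= mul1n; apply: eq_big_nat => k _.
by rewrite /paths_to subn0.
Qed.

End Completions.

(** * Summation in closed form over the rationals *)

Import GRing.Theory Num.Theory.
Local Open Scope ring_scope.

Lemma fact_neq0 (m : nat) : (m`!)%:R != 0 :> rat.
Proof. by rewrite pnatr_eq0 -lt0n fact_gt0. Qed.

Lemma natr_factS (m : nat) : (m.+1`!)%:R = (m%:R + 1) * (m`!)%:R :> rat.
Proof. by rewrite factS natrM natr1. Qed.

Lemma paths_two_equal_rows (n k : nat) : (k <= n)%N ->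
  (paths (n + n + k) 0 0 0 n n k)%:R =
  ((n + n + k)`!)%:R * ((n%:R - k%:R + 2) * (n%:R - k%:R + 1)) /
    ((n.+2`!)%:R * (n.+1`!)%:R * (k`!)%:R) :> rat.
Proof.
move=> le_kn; have H := @paths_hook_length (n + n + k) k (n - k) 0.
rewrite !addn0 subnKC // mul1n in H.
apply: (canRL (mulfK _)); first by rewrite !mulf_neq0 ?fact_neq0.
rewrite -!natrM H; last by lia.
by rewrite !natrM -!natr1 natrB // -addrA.
Qed.

(* The summand is a hypergeometric term in [k], and Gosper's algorithm yields
   the antiderivative on the right. *)
Lemma sum_paths_two_equal_rows (n m : nat) : (m <= n.+1)%N ->
  (\sum_(0 <= k < m) paths (n + n + k) 0 0 0 n n k)%:R =
  m%:R * ((n + n + m)`!)%:R / ((n.+2`!)%:R * (n.+1`!)%:R * (m`!)%:R) *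
  ((n%:R + 1) * (n%:R + 2) / (2 * n%:R + 1) +
   (m%:R ^+ 2 - 2 * (n%:R + 3) * m%:R + 2 * n%:R + 5) / (2 * n%:R + 3)) :> rat.
Proof.
have n0 : 0 <= n%:R :> rat by [].
elim: m => [|m IH] lt_mn; first by rewrite big_geq // !mul0r.
rewrite big_nat_recr //= natrD IH ?(ltnW lt_mn) //.
rewrite paths_two_equal_rows // addnS (natr_factS (n + n + m)) (natr_factS m).
rewrite -[m.+1%:R]natr1 [(n + n + m)%:R]natrD [(n + n)%:R]natrD.
have := fact_neq0 m; have := fact_neq0 n.+1; have := fact_neq0 n.+2.
have m0 : 0 <= m%:R :> rat by [].
move: n0 m0 {IH lt_mn}; set x := n%:R; set y := m%:R.
set f := (_.+2`!)%:R; set g := (_.+1`!)%:R; set h := (m`!)%:R.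
move=> x0 y0 f0 g0 h0; clearbody x y f g h; field.
by repeat (apply/andP; split) => //; apply: lt0r_neq0; lra.
Qed.

Theorem proposition5p1 (n : nat) :
  #|A_avoiding (2 * n + 1) p2143|%:R =
    (2 * (3 * n + 3)`!)%N%:R /
    (n`! * n.+1`! * n.+2`! * ((2 * n + 1) * (2 * n + 2) * (2 * n + 3)))%N%:R
    :> rat.
Proof.
have E : (2 * n + 1)%N = n.*2.+1 by lia.
transitivity (#|A_avoiding n.*2.+1 p2143|%:R : rat); first by rewrite E.
rewrite card_A_avoiding descendants_root sum_paths_two_equal_rows //.
have -> : (3 * n + 3 = (n + n + n.+1).+2)%N by lia.
(* All factorials are expressed through n, n! and (3n + 1)!, leaving a rational identity. *)
pose x : rat := n%:R; pose f : rat := (n`!)%:R.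
pose h : rat := ((n + n + n.+1)`!)%:R.
have Ef1 : (n.+1`!)%:R = (x + 1) * f by rewrite natr_factS.
have Ef2 : (n.+2`!)%:R = (x + 2) * ((x + 1) * f).
  by rewrite natr_factS Ef1 -natr1 -addrA.
have Eh : ((n + n + n.+1).+2`!)%:R = (3 * x + 3) * ((3 * x + 2) * h).
  rewrite !natr_factS -[(_ + _).+1%:R]natr1 [(n + n + n.+1)%:R]natrD.
  by rewrite [(n + n)%:R]natrD -natr1 -/x -/h; ring.
have Ed : ((2 * n + 1) * (2 * n + 2) * (2 * n + 3))%N%:R =
    (2 * x + 1) * (2 * x + 2) * (2 * x + 3) :> rat.
  by rewrite /x; ring.
rewrite [(2 * _)%N%:R]natrM [in RHS](natrM _ _ (_ * _ * _)%N) Ed.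
rewrite [(_ * _ * n.+2`!)%N%:R]natrM [(n`! * _)%N%:R]natrM Ef2 Eh Ef1.
rewrite -[n.+1%:R]natr1 -/x -/f -/h.
have x0 : 0 <= x by []; have f0 : f != 0 by apply: fact_neq0.
clearbody x f h; clear - x0 f0; field.
by repeat (apply/andP; split) => //; apply: lt0r_neq0; lra.
Qed.
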